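(* For every integer $d \ge 2$, there exists a graph $G$ with $\delta^\star(G)=d$ and $\chi_{\ell}^{\star}(G) \ge d+2$.
   Context: Graphs are finite and simple. The degeneracy $\delta^\star(G)$ is the maximum over all subgraphs $H$ of $G$ of the minimum degree of $H$. A list-assignment $L$ of $G$ maps each vertex $v\in V(G)$ to a set $L(v)\subseteq\mathbb{N}$ of colours; it is a $k$-list-assignment if $|L(v)|=k$ for every $v$. A proper $L$-colouring is a map $c:V(G)\to\mathbb{N}$ with $c(v)\in L(v)$ for all $v$ and $c(u)\neq c(v)$ for every edge $uv$. A proper $L$-packing of $G$ of size $k$ is a collection of $k$ proper $L$-colourings $c_1,\dots,c_k$ that are mutually disjoint, i.e. $c_i(v)\neq c_j(v)$ for all $i\neq j$ and all $v\in V(G)$. The list packing number $\chi^\star_\ell(G)$ is the least $k$ such that $G$ admits a proper $L$-packing of size $k$ for every $k$-list-assignment $L$ of $G$. *)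

(* Defs.v *)
From mathcomp Require Import all_boot all_fingroup finmap boolp.

Set Implicit Arguments.
Unset Strict Implicit.
Unset Printing Implicit Defensive.

Record sgraph := SGraph {
  vertex :> finType;
  edge : rel vertex;
  edge_sym : symmetric edge;
  edge_irr : irreflexive edge }.

(* A subgraph is a set S of vertices together with a set F of edges between
   vertices of S.  F is a symmetric set of ordered pairs: each unordered edge
   appears in both orientations. *)
Definition is_subgraph (G : sgraph) (S : {set G}) (F : {set G * G}) : bool :=
  [forall u, forall v, ((u, v) \in F) ==>
    [&& edge u v, u \in S, v \in S & (v, u) \in F]].

Definition sub_degree (G : sgraph) (F : {set G * G}) (v : G) : nat :=
  #|[set u | (v, u) \in F]|.

(* For nonempty S the neutral value #|G| is irrelevant, as degrees in a
   subgraph of G are smaller than #|G|. *)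
Definition min_degree (G : sgraph) (S : {set G}) (F : {set G * G}) : nat :=
  \big[minn/#|G|]_(v in S) sub_degree F v.

Definition degeneracy (G : sgraph) : nat :=
  \max_(H : {set G} * {set G * G} | (H.1 != set0) && is_subgraph H.1 H.2)
    min_degree H.1 H.2.

Definition is_list_assignment (G : sgraph) (k : nat) (L : G -> {fset nat}) :=
  forall v : G, #|` L v| = k.

Definition proper_coloring (G : sgraph) (L : G -> {fset nat}) (c : G -> nat) :=
  (forall v : G, c v \in L v) /\ (forall u v : G, edge u v -> c u <> c v).

Definition proper_packing (G : sgraph) (L : G -> {fset nat}) (k : nat)
    (c : 'I_k -> G -> nat) :=
  (forall i, proper_coloring L (c i)) /\
  (forall i j, i <> j -> forall v : G, c i v <> c j v).

Definition list_packable (G : sgraph) (k : nat) :=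
  forall L : G -> {fset nat}, is_list_assignment k L ->
    exists c : 'I_k -> G -> nat, proper_packing L c.

Lemma avoiding_perm (k n : nat) (bad : rel 'I_k) : n.*2 < k ->
  (forall i, #|[set j | bad i j]| <= n) ->
  (forall j, #|[set i | bad i j]| <= n) ->
  exists s : {perm 'I_k}, forall i, ~~ bad i (s i).
Proof.
move=> nk row col.
pose B (s : {perm 'I_k}) := [set i | bad i (s i)].
case: (@arg_minnP _ (1%g : {perm 'I_k}) xpredT (fun s => #|B s|) isT) => s _ smin.
exists s => i; apply/negP => bi.
pose X := (s @^-1: [set j | bad i j]) :|: [set j | bad j (s i)].
have : #|X| < #|[set: 'I_k]|.
  rewrite cardsT card_ord; apply: leq_ltn_trans (leq_card_setU _ _) _.
  rewrite card_preimset; last exact: perm_inj.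
  by apply: leq_ltn_trans nk; rewrite -addnn leq_add.
move=> ltX; have /subsetPn[j _] : ~~ ([set: 'I_k] \subset X).
  by apply: contraL ltX => /subset_leq_card; rewrite leqNgt.
rewrite !inE negb_or => /andP[nij nji].
have := smin (tperm i j * s)%g isT; rewrite leqNgt => /negP; apply.
apply/proper_card/properP; split.
  apply/subsetP => x; rewrite !inE permM.
  case: tpermP => [->|->|//]; first by rewrite (negbTE nij).
  by rewrite (negbTE nji).
by exists i; rewrite inE // permM tpermL.
Qed.

Lemma list_packable_large (G : sgraph) : list_packable G (#|G|.*2.+1).
Proof.
move=> L kL; set k := #|G|.*2.+1 in kL *.
suff [c [cL cD cP]] : exists c : 'I_k -> G -> nat,
    [/\ forall i v, v \in enum G -> c i v \in L v,
        forall i j v, v \in enum G -> c i v = c j v -> i = j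
      & forall i u v, u \in enum G -> v \in enum G -> edge u v -> c i u <> c i v].
  exists c; split=> [i|i j ij v /cD e]; last by apply/ij/e; rewrite mem_enum.
  by split=> [v|u v]; [apply: cL | apply: cP]; rewrite mem_enum.
elim: (enum G) => [|v s [c [cL cD cP]]]; first by exists (fun _ _ => 0).
have [vs|vs] := boolP (v \in s).
  have E x : (x \in v :: s) = (x \in s).
    by rewrite inE; case: eqP => [->|//]; rewrite vs.
  exists c; split=> [i u|i j u|i u w]; rewrite !E; [exact: cL|exact: cD|exact: cP].
pose g (j : 'I_k) : nat := nth 0 (L v) j.
have gL j : g j \in L v by apply: mem_nth; rewrite (kL v).
have gI : injective g.
  move=> i j /eqP; rewrite nth_uniq ?(kL v) ?ltn_ord ?fset_uniq //.
  by move=> /eqP/val_inj.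
pose bad (i j : 'I_k) := [exists u, (u \in s) && (g j == c i u)].
have small (P : G -> pred 'I_k) :
    (forall u i j, P u i -> P u j -> i = j) ->
    #|[set j | [exists u, P u j]]| <= #|G|.
  move=> Pu; rewrite cardsE -sum1_card.
  apply: (@leq_trans (\sum_(u : G) \sum_(j | P u j) 1)).
    rewrite (exchange_big_dep xpredT) //= big_mkcond leq_sum // => j _.
    rewrite unfold_in; case: existsP => // -[u Puj].
    by rewrite (bigD1 u).
  rewrite -sum1_card leq_sum // => u _; rewrite sum1_card.
  by apply/card_le1_eqP => i j Pi Pj; exact: (Pu u).
have [||t tP] := @avoiding_perm k #|G| bad (ltnSn _).
- move=> i; apply: (small (fun u j => (u \in s) && (g j == c i u))).
  by move=> u j j' /andP[_ /eqP e] /andP[_ /eqP e']; apply: gI; rewrite e.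
- move=> j; apply: (small (fun u i => (u \in s) && (g j == c i u))).
  move=> u i i' /andP[us /eqP e] /andP[_ /eqP e'].
  by apply: (cD _ _ _ us); rewrite -e.
have tN i u : u \in s -> g (t i) <> c i u.
  by move=> us e; case/existsP: (tP i); exists u; rewrite us e eqxx.
have vN u : u \in s -> (u == v) = false by move=> us; apply: contraNF vs => /eqP <-.
exists (fun i u => if u == v then g (t i) else c i u); split.
- move=> i u; rewrite inE; case: eqP => [->|_ /=] // us; exact: cL.
- move=> i j u; rewrite inE; case: eqP => [_ _ /gI/perm_inj|_ /=] //; exact: cD.
- move=> i u w; rewrite !inE; case: (u =P v) => [->|_] /=; last first.
    case: (w =P v) => [_|_] /= us ws uw; last exact: cP.
    exact/nesym/tN.
  case: (w =P v) => [->|_] /= _ ws; first by rewrite edge_irr.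
  by move=> _; apply: tN.
Qed.

Lemma list_packing_number_exists (G : sgraph) :
  exists k, (0 < k) && `[< list_packable G k >].
Proof. by exists #|G|.*2.+1; apply/asboolP/list_packable_large. Qed.

(* The least k is taken among positive integers: for k = 0 the empty
   collection is vacuously a packing for every graph. *)
Definition list_packing_number (G : sgraph) : nat :=
  ex_minn (list_packing_number_exists G).

(* Main.v *)
From HB Require Import structures.
Require Import Defs.
From mathcomp Require Import all_boot.
From mathcomp Require Import finmap boolp.
From mathcomp Require Import zify.

(** Write k = d + 1.  A proper packing of size k for lists of size k uses, at
    each vertex, each colour of the list at exactly one of the k indices.  The
    graph below has three layers, and every vertex has at most d neighbours in
    its own and the lower layers, so its degeneracy is at most d.

    The bottom layer is a clique of k roots with lists {0,..,d}, which makes the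
    degeneracy equal to d and excludes packings of positive size less
    than k when all lists are equal.  In a
    packing of size k, the colours of the roots form a Latin square.  A middle
    vertex [twin j a] is joined to all roots but the j-th and has the list
    {0,..,d+1} without a; index by index it can only repeat the colour of
    [root j] or take the new colour d + 1, so it is forced to be the copy of
    [root j] in which a is replaced by d + 1 ([twin_colour]).

    The top vertex [apex f] is joined to [twin j (f j)] for the d values j < d.
    Let i* be the index at which the last root has colour d.  As the square is
    Latin, at every other index the colour d occurs at exactly one [root j] with
    j < d, and it survives in [twin j (f j)] because f j < d.  Choosing f j to be
    the colour of [root j] at the index where the cyclically next root has
    colour d puts the colour d + 1 at every index other than i* as well; here
    d >= 2 ensures that the next root is another one.  Both d and d + 1 belong
    to the list of [apex f] and both are only available at i*, which is absurd.
    Since f depends on the packing, the graph has one apex for every f. *)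

Set Implicit Arguments.
Unset Strict Implicit.
Unset Printing Implicit Defensive.

(** * Degeneracy and packings of general graphs *)

Lemma injective_full_codom (n : nat) (T : eqType) (f : 'I_n -> T) (s : seq T) x :
  injective f -> (forall i, f i \in s) -> size s <= n -> x \in s ->
  exists i, f i = x.
Proof.
move=> fI fs sn xs.
have sub : {subset codom f <= s} by move=> _ /codomP[i ->].
have uf : uniq (codom f) by apply/injectiveP.
have [|_ E] := uniq_min_size uf sub; first by rewrite size_codom card_ord.
by move: xs; rewrite -E => /codomP[i ->]; exists i.
Qed.

Lemma min_degree_le (G : sgraph) (S : {set G}) (F : {set G * G}) (v : G) :
  v \in S -> min_degree S F <= sub_degree F v.
Proof.
rewrite /min_degree => vS; have := mem_index_enum v.
elim: (index_enum G) => //= x s IH; rewrite inE big_cons.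
case/predU1P => [<-|/IH le]; first by rewrite vS geq_minl.
by case: ifP => // _; apply: leq_trans (geq_minr _ _) le.
Qed.

(** In any subgraph, a vertex of largest rank has only neighbours of no larger
    rank. *)
Lemma degeneracy_le_rank (G : sgraph) (r : G -> nat) (d : nat) :
  (forall v : G, #|[set w | edge v w & r w <= r v]| <= d) -> degeneracy G <= d.
Proof.
move=> rd; apply/bigmax_leqP => -[S F] /= /andP[/set0Pn[v0 v0S] /forallP subF].
case: (@arg_maxnP _ v0 (mem S) r v0S) => v vS vmax.
apply: leq_trans (min_degree_le F vS) (leq_trans _ (rd v)).
apply/subset_leq_card/subsetP => w; rewrite !inE => vw.
have /forallP/(_ w) := subF v; rewrite vw /= => /and4P[-> _ wS _].
exact: vmax.
Qed.

Lemma degeneracy_ge_clique (G : sgraph) (n : nat) (q : 'I_n.+1 -> G) :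
  injective q -> (forall i j, i != j -> edge (q i) (q j)) -> n <= degeneracy G.
Proof.
move=> qI qE.
pose S := [set q i | i : 'I_n.+1].
pose F := [set e : G * G | [&& edge e.1 e.2, e.1 \in S & e.2 \in S]].
have SF : (S != set0) && is_subgraph S F.
  apply/andP; split; first by apply/set0Pn; exists (q ord0); apply: imset_f.
  apply/forallP => u; apply/forallP => v; apply/implyP.
  by rewrite !inE /= => /and3P[uv uS vS]; rewrite (edge_sym v) uv uS vS.
have nG : n <= #|G|.
  by apply: ltnW; rewrite -[n.+1]card_ord -(card_imset _ qI) max_card.
apply: leq_trans (leq_bigmax_cond (S, F) SF); rewrite /= /min_degree.
apply: (big_ind (leq n)) => // [x y nx ny|_ /imsetP[i _ ->]].
  by rewrite leq_min nx.
have -> : n = #|q @: [set~ i]| by rewrite card_imset // cardsC1 card_ord.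
apply/subset_leq_card/subsetP => _ /imsetP[j + ->]; rewrite !inE /= => ji.
by rewrite qE 1?eq_sym // !imset_f.
Qed.

Lemma packable_ge_clique (G : sgraph) (n k : nat) (q : 'I_n -> G) :
  (forall i j, i != j -> edge (q i) (q j)) -> 0 < k -> list_packable G k ->
  n <= k.
Proof.
case: k => // k qE _ /(_ (fun=> [fset x in iota 0 k.+1]%fset)) [].
  by move=> v; rewrite card_fseq undup_id ?iota_uniq ?size_iota.
move=> c [/(_ ord0)[cL cP] _].
rewrite -[n]card_ord -(size_codom (c ord0 \o q)) -[leqRHS](size_iota 0).
apply: uniq_leq_size => [|_ /codomP[i ->]]; last by have := cL (q i); rewrite in_fset.
by apply/injectiveP => i j /= e; apply/eqP/negPn/negP => /qE/cP/(_ e).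
Qed.

Lemma packing_onto (G : sgraph) (k : nat) (L : G -> {fset nat}) c (v : G) x :
  is_list_assignment k L -> @proper_packing G L k c -> x \in L v ->
  exists i, c i v = x.
Proof.
move=> Lk [cP cD]; apply: injective_full_codom.
- by move=> i j e; apply: contrapT => /cD/(_ v).
- by move=> i; case: (cP i).
- by rewrite (Lk v).
Qed.

(** * The layered graph *)

Section LayeredGraph.

Variable d : nat.

Definition layered_vertex : Type :=
  ('I_d.+1 + 'I_d * 'I_d + {ffun 'I_d -> 'I_d})%type.

HB.instance Definition _ := Finite.on layered_vertex.

Definition root l : layered_vertex := inl (inl l).
Definition twin j a : layered_vertex := inl (inr (j, a)).
Definition apex f : layered_vertex := inr f.

Definition layered_edge (v w : layered_vertex) : bool :=
  match v, w with
  | inl (inl l), inl (inl l') => l != l'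
  | inl (inl l), inl (inr t) | inl (inr t), inl (inl l) => l != t.1 :> nat
  | inl (inr t), inr f | inr f, inl (inr t) => f t.1 == t.2
  | _, _ => false
  end.

Lemma layered_edge_sym : symmetric layered_edge.
Proof. by case=> [[l|t]|f] [[l'|t']|f'] //=; rewrite eq_sym. Qed.

Lemma layered_edge_irr : irreflexive layered_edge.
Proof. by case=> [[l|t]|f] //=; rewrite eqxx. Qed.

Definition layered : sgraph := SGraph layered_edge_sym layered_edge_irr.

Definition layer (v : layered) : nat :=
  match v with inl (inl _) => 0 | inl (inr _) => 1 | inr _ => 2 end.

Lemma root_inj : injective (root : _ -> layered).
Proof. by move=> l l' []. Qed.

Lemma lower_degree (v : layered) :
  #|[set w | edge v w & layer w <= layer v]| <= d.
Proof.
have rootsD l : #|(root : _ -> layered) @: [set~ l]| = d.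
  by rewrite card_imset ?cardsC1 ?card_ord //; apply: root_inj.
case: v => [[l|[j a]]|f].
- rewrite -[leqRHS](rootsD l); apply/subset_leq_card/subsetP.
  case=> [[l'|t]|f]; rewrite !inE //= ?andbF // andbT => ll'.
  by apply: imset_f; rewrite !inE eq_sym.
- rewrite -[leqRHS](rootsD (widen_ord (leqnSn d) j)).
  apply/subset_leq_card/subsetP => -[[l'|t]|f]; rewrite !inE //= ?andbF //.
  by rewrite andbT => lj; apply: imset_f; rewrite !inE -val_eqE.
- apply: leq_trans (leq_trans (leq_imset_card _ _) _);
    last by rewrite -[leqRHS]card_ord; apply: max_card.
  have sub : [set w | edge (inr f : layered) w & layer w <= layer (inr f : layered)]
      \subset [set (twin j (f j) : layered) | j in 'I_d].
    apply/subsetP => -[[l'|[j a]]|f']; rewrite !inE //= andbT => /eqP <-.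
    by apply/imsetP; exists j.
  exact: subset_leq_card sub.
Qed.

Lemma layered_degeneracy : degeneracy layered = d.
Proof.
apply/eqP; rewrite eqn_leq (degeneracy_le_rank lower_degree) /=.
exact: (degeneracy_ge_clique root_inj).
Qed.

(** * The lists without a packing *)

(** Every list is {0,..,d+1} without one colour.  At an apex it is 0 so
    that d and d + 1 both stay in the list. *)
Definition omitted (v : layered) : nat :=
  match v with inl (inl _) => d.+1 | inl (inr t) => t.2 | inr _ => 0 end.

Definition hard_list (v : layered) : {fset nat} :=
  [fset x in rem (omitted v) (iota 0 d.+2)]%fset.

Lemma omitted_lt v : omitted v < d.+2.
Proof. by case: v => [[l|[j a]]|f] //=; have := ltn_ord a; lia. Qed.

Lemma in_hard_list v x : (x \in hard_list v) = (x != omitted v) && (x < d.+2).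
Proof. by rewrite in_fset mem_rem_uniq ?iota_uniq // inE mem_iota. Qed.

Lemma hard_list_size : is_list_assignment d.+1 hard_list.
Proof.
move=> v; rewrite card_fseq undup_id ?rem_uniq ?iota_uniq //.
by rewrite size_rem ?size_iota // mem_iota omitted_lt.
Qed.

Section Packing.

Variable c : 'I_d.+1 -> layered -> nat.
Hypothesis cP : proper_packing hard_list c.

Let below j : 'I_d.+1 := widen_ord (leqnSn d) j.

Lemma colour_in i v : c i v \in hard_list v.
Proof. by case: cP => /(_ i)[]. Qed.

Lemma colour_edge i (v w : layered) : edge v w -> c i v != c i w.
Proof. by case: cP => /(_ i)[_ p] _ /p/eqP. Qed.

Lemma colour_disjoint v i i' : c i v = c i' v -> i = i'.
Proof. by case: cP => _ p e; apply: contrapT => /p/(_ v). Qed.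

Lemma colour_onto v x : x \in hard_list v -> exists i, c i v = x.
Proof. exact: packing_onto hard_list_size cP. Qed.

Lemma root_colour_lt i l : c i (root l) < d.+1.
Proof. by have := colour_in i (root l); rewrite in_hard_list /=; lia. Qed.

Lemma root_colour_inj i l l' : c i (root l) = c i (root l') -> l = l'.
Proof.
move=> e; apply/eqP/negPn/negP => ll'.
by have := @colour_edge i (root l) (root l') ll'; rewrite e eqxx.
Qed.

(** The roots form a clique of d + 1 vertices coloured from d + 1 colours. *)
Lemma root_row_onto i x : x < d.+1 -> exists l, c i (root l) = x.
Proof.
move=> xd; apply: (@injective_full_codom _ _ _ (iota 0 d.+1)).
- exact: root_colour_inj.
- by move=> l; rewrite mem_iota root_colour_lt.
- by rewrite size_iota.
- by rewrite mem_iota.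
Qed.

(** The other roots exhaust all colours up to d except that of [root j]. *)
Lemma twin_colour_or i j a :
  c i (twin j a) = c i (root (below j)) \/ c i (twin j a) = d.+1.
Proof.
have := colour_in i (twin j a); rewrite in_hard_list /= => /andP[_ ltd].
have [e|lt'] := leqP d.+1 (c i (twin j a)); [right; lia | left].
have [l e] := root_row_onto i lt'; rewrite -e; congr (c i (root _)).
apply/val_inj/eqP/negPn/negP => lj.
by have := @colour_edge i (root l) (twin j a) lj; rewrite e eqxx.
Qed.

Lemma twin_colour i j (a : 'I_d) :
  c i (twin j a) =
    if c i (root (below j)) == a then d.+1 else c i (root (below j)).
Proof.
have noa i' : c i' (twin j a) != a.
  by have := colour_in i' (twin j a); rewrite in_hard_list => /andP[].
(* The colour d + 1 is spent at the index where [root j] has colour a. *)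
have new i' : c i' (root (below j)) = a -> c i' (twin j a) = d.+1.
  by move=> e; case: (twin_colour_or i' j a) => // e'; case/eqP: (noa i'); lia.
case: eqP => [/new //|na]; case: (twin_colour_or i j a) => // e.
have [|i' ai'] := @colour_onto (root (below j)) a.
  by rewrite in_hard_list /=; have := ltn_ord a; lia.
by case: na; rewrite (@colour_disjoint (twin j a) i i') // e new.
Qed.

(** The apex has d + 1 colours for d + 1 indices, so it must use both d and
    d + 1, at two different indices; the choice of f leaves a single index at
    which its twins allow either of them. *)
Lemma hard_packing_absurd : 2 <= d -> False.
Proof.
move=> d2.
have topL l : d \in hard_list (root l) by rewrite in_hard_list /=; lia.
have [pos posE] := choice (fun l => colour_onto (topL l)).
have posU l i : c i (root l) = d -> i = pos l.
  by move=> e; apply: (@colour_disjoint (root l)); rewrite e posE.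
have ordS_neq (j : 'I_d) : ordS j != j.
  apply/eqP => /(congr1 val) /=; have := ltn_ord j => jd.
  have [e|ne] := eqVneq j.+1 d; first by rewrite e modnn; lia.
  by rewrite modn_small; lia.
have f_lt (j : 'I_d) : c (pos (below (ordS j))) (root (below j)) < d.
  have := root_colour_lt (pos (below (ordS j))) (below j).
  rewrite ltnS leq_eqVlt => /predU1P[e|//].
  have e' : below j = below (ordS j).
    by apply: (@root_colour_inj (pos (below (ordS j)))); rewrite e posE.
  by case/eqP: (ordS_neq j); apply/val_inj/esym/(congr1 val e').
pose f := [ffun j => Ordinal (f_lt j)].
have fE j : edge (apex f : layered) (twin j (f j)) by rewrite /= eqxx.
have blocked i : i != pos ord_max -> c i (apex f) != d /\ c i (apex f) != d.+1.
  move=> ni; have [l e] := root_row_onto i (ltnSn d).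
  have ld : l < d.
    have : l != ord_max by apply: contraNneq ni => <-; apply/eqP/posU.
    by rewrite -val_eqE /=; have := ltn_ord l; lia.
  pose j := Ordinal ld; have {}e : c i (root (below j)) = d.
    by rewrite -e; congr (c i (root _)); apply: val_inj.
  split.
    have := colour_edge i (fE j); rewrite twin_colour e.
    by rewrite ifN // gtn_eqF // ltn_ord.
(* The twin of the cyclic predecessor of j replaces by d + 1 exactly the colour
   that its root has at the index i. *)
  have := colour_edge i (fE (ord_pred j)); rewrite twin_colour ffunE /=.
  by rewrite ord_predK -(posU _ _ e) eqxx.
have [|i1 e1] := @colour_onto (apex f) d; first by rewrite in_hard_list /=; lia.
have [|i2 e2] := @colour_onto (apex f) d.+1; first by rewrite in_hard_list /=; lia.
have E1 : i1 = pos ord_max by apply/eqP/negPn/negP => /blocked[]; rewrite e1 eqxx.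
have E2 : i2 = pos ord_max.
  by apply/eqP/negPn/negP => /blocked[_]; rewrite e2 eqxx.
by move: e1; rewrite E1 -E2 e2; lia.
Qed.

End Packing.

End LayeredGraph.

Theorem theorem25 (d : nat) (hd : 2 <= d) :
  exists G : sgraph, degeneracy G = d /\ d + 2 <= list_packing_number G.
Proof.
exists (layered d); split; first exact: layered_degeneracy.
rewrite /list_packing_number.
case: ex_minnP => k /andP[k0 /asboolP pk] _.
have := @packable_ge_clique (layered d) _ k (@root d) (fun _ _ => id) k0 pk.
rewrite leq_eqVlt => /predU1P[ek|]; last by rewrite addn2.
move: pk; rewrite -ek => /(_ _ (@hard_list_size d))[c cP].
by case: (hard_packing_absurd cP).
Qed.
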